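(* There are infinitely many odd positive integers $d$ for which there is a positive integer $k$ with $$d^2 = 12k^2+1,$$ and for every pair of positive integers $d,k$ satisfying this equation there are at least three different polynomials in $\mathcal{H}(2,d)$ each of which has exactly $\frac{d+3}{2}$ distinct nonzero monomials.
   Context: $\mathcal{H}(2)$ denotes the set of polynomials $p\in\mathbf{R}[x,y]$ all of whose coefficients are nonnegative and which satisfy $p(x,y)=1$ for all $(x,y)$ on the line $x+y=1$. $\mathcal{H}(2,d)$ denotes the set of elements of $\mathcal{H}(2)$ of (total) degree $d$. The number of distinct nonzero monomials of $p$ is the number of monomials $x^ay^b$ whose coefficient in $p$ is nonzero. *)

(* Defs.v *)
From mathcomp Require Import all_boot all_order all_algebra.
From mathcomp Require Import classical_sets cardinality reals.
From mathcomp Require Import mpoly.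

Set Implicit Arguments.
Unset Strict Implicit.
Unset Printing Implicit Defensive.

Import Order.TTheory GRing.Theory Num.Theory.

Local Open Scope classical_set_scope.
Local Open Scope ring_scope.

Definition H2 (R : realType) : set {mpoly R[2]} :=
  [set p | (forall m : 'X_{1..2}, 0 <= p@_m) /\
           (forall x y : R, x + y = 1 -> p.@[tnth [tuple x; y]] = 1)].

(* [msize p] is one more than the total degree of [p], and 0 for [p = 0]. *)
Definition H2d (R : realType) (d : nat) : set {mpoly R[2]} :=
  [set p | H2 p /\ msize p = d.+1].

(* [msupp p] lists the monomials with nonzero coefficient, without repetition. *)
Definition num_monomials (R : realType) (p : {mpoly R[2]}) : nat :=
  size (msupp p).

(* Main.v *)
(* Let L_n be the Lucas polynomials, L_0 = 2, L_1 = x, L_(n+2) = x L_(n+1) + y L_n.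
   On the line x + y = 1 the roots of t^2 = x t + y are 1 and -y, so L_n = 1 + (-y)^n.
   Hence for d = 2h + 1 the polynomial y^d + L_d equals 1 on the line; it has
   nonnegative coefficients and h + 2 terms, and exchanging x and y gives a second
   such polynomial. For the third, subtract (d/2) x y^(h-k) (L_(2k) - y^(2k) - 1), which
   vanishes on the line. The coefficients of x y^h always cancel, and those of
   x^3 y^(h-1) cancel exactly when d^2 = 12 k^2 + 1, so the two new terms x y^(h-k) and
   x y^(h+k) replace these two; comparing ratios of consecutive coefficients shows
   that the remaining coefficients stay positive. *)
Require Import Defs.
From mathcomp Require Import all_boot all_order all_algebra.
From mathcomp Require Import classical_sets cardinality reals.
From mathcomp Require Import mpoly.
From mathcomp Require Import zify ring.

Set Implicit Arguments.
Unset Strict Implicit.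
Unset Printing Implicit Defensive.

Import Order.TTheory GRing.Theory Num.Theory.

Local Open Scope classical_set_scope.
Local Open Scope ring_scope.

(** * Coefficients of the Lucas polynomials *)

(* Coefficients of x^(2j) y^(k-j) in L_(2k) and of x^(2j+1) y^(h-j) in L_(2h+1). For
   k = j = 0 the junk value [0.-1 = 0] produces the correct coefficient 2 of L_0. *)
Definition lucas_even (k j : nat) : nat :=
  ('C(k + j, j.*2) + 'C((k + j).-1, j.*2))%N.
Definition lucas_odd (h j : nat) : nat :=
  ('C((h + j).+1, j.*2.+1) + 'C(h + j, j.*2.+1))%N.

Lemma lucas_even_small (k j : nat) : (k < j)%N -> lucas_even k j = 0%N.
Proof. by move=> kj; rewrite /lucas_even !bin_small //; lia. Qed.

Lemma lucas_odd_small (h j : nat) : (h < j)%N -> lucas_odd h j = 0%N.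
Proof. by move=> hj; rewrite /lucas_odd !bin_small //; lia. Qed.

Lemma lucas_even0 (k : nat) : lucas_even k 0 = 2%N.
Proof. by rewrite /lucas_even !bin0. Qed.

Lemma lucas_odd0 (h : nat) : lucas_odd h 0 = h.*2.+1.
Proof. by rewrite /lucas_odd !bin1; lia. Qed.

(** This is L_(n+2) = x L_(n+1) + y L_n read off on coefficients, for even n; Pascal's rule proves
    it. *)
Lemma lucas_evenS (k j : nat) :
  lucas_even k.+1 j.+1 = (lucas_odd k j + lucas_even k j.+1)%N.
Proof.
rewrite /lucas_even /lucas_odd doubleS !addSn !addnS /= !binS; lia.
Qed.

Lemma lucas_oddS (h j : nat) :
  lucas_odd h.+1 j = (lucas_even h.+1 j + lucas_odd h j)%N.
Proof.
rewrite /lucas_even /lucas_odd !addSn /= (binS (h + j).+1).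
rewrite (binS (h + j) j.*2); ring.
Qed.

(** The classical coefficient n/(n-i) C(n-i, i) of x^(n-2i) y^i in L_n, rewritten without
    division. *)
Lemma lucas_even_closed (k j : nat) :
  (lucas_even k.+1 j.+1 * j.*2.+2 = k.+1.*2 * 'C(k.+1 + j, j.*2.+1))%N.
Proof.
rewrite /lucas_even doubleS addnS /= mulnDl -!(mulnC j.*2.+2).
rewrite -mul_bin_diag mul_bin_left.
have [jk|kj] := leqP j k; last by rewrite !bin_small; lia.
by rewrite -mulnDl; congr (_ * _)%N; lia.
Qed.

Lemma lucas_odd_closed (h j : nat) :
  (lucas_odd h j * j.*2.+1 = h.*2.+1 * 'C(h + j, j.*2))%N.
Proof.
rewrite /lucas_odd mulnDl -!(mulnC j.*2.+1) -mul_bin_diag mul_bin_left.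
have [jk|kj] := leqP j h; last by rewrite !bin_small; lia.
by rewrite -mulnDl; congr (_ * _)%N; lia.
Qed.

Lemma lucas_even_ratio (k j : nat) :
  (lucas_even k j.+1 * (j.*2.+1 * j.*2.+2) =
   lucas_even k j * ((k - j) * (k + j)))%N.
Proof.
case: k => [|k]; first by rewrite lucas_even_small // sub0n muln0.
have [jk|kj] := leqP j k.+1; last by rewrite !lucas_even_small //; lia.
have E := lucas_even_closed k j.
(* [lucas_even_closed] does not reach index 0, so index j gets its own form, with a binomial from
   the same row as the one in [E]. *)
have F : (lucas_even k.+1 j * (k.+1 + j) = k.+1.*2 * 'C(k.+1 + j, j.*2))%N.
  rewrite /lucas_even mulnDl -!(mulnC (k.+1 + j)%N) mul_bin_down -mulnDl.
  by congr (_ * _)%N; lia.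
have := mul_bin_left (k.+1 + j) j.*2.
have -> : (k.+1 + j - j.*2 = k.+1 - j)%N by lia.
move: E F; move: 'C(_, j.*2) 'C(_, j.*2.+1) => u w E F G.
rewrite (mulnC j.*2.+1) mulnA E -mulnA (mulnC w) G.
by rewrite mulnCA -F; ring.
Qed.

Lemma lucas_odd_ratio (h j : nat) :
  (lucas_odd h j.+1 * (j.*2.+2 * j.*2.+3) =
   lucas_odd h j * ((h - j) * (h + j).+1))%N.
Proof.
have [jh|hj] := leqP j h; last by rewrite !lucas_odd_small //; lia.
have := lucas_odd_closed h j.
have := lucas_odd_closed h j.+1.
have := mul_bin_diag (h + j).+1 j.*2.+1.
have := mul_bin_left (h + j) j.*2.
have -> : (h + j - j.*2 = h - j)%N by lia.
rewrite addnS doubleS /=.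
move: 'C(_, j.*2) 'C(_, j.*2.+1) 'C(_, j.*2.+2) => v w u G F E' E.
(* The extra factor 2j+1 is what [lucas_odd_closed] at j consumes. *)
apply/eqP; rewrite -(eqn_pmul2r (ltn0Sn j.*2)); apply/eqP.
transitivity (lucas_odd h j.+1 * j.*2.+3 * j.*2.+2 * j.*2.+1)%N; first by ring.
rewrite E' -(mulnA _ u) (mulnC u) -F.
transitivity (h.*2.+1 * (h + j).+1 * (j.*2.+1 * w))%N; first by ring.
rewrite G.
transitivity (h.*2.+1 * v * ((h - j) * (h + j).+1))%N; first by ring.
by rewrite -E; ring.
Qed.

(** * Comparison of coefficients under the Pell equation *)

Lemma pell_bound (h k : nat) : (0 < k)%N -> (h * h.+1 = 3 * k ^ 2)%N ->
  (k < h)%N /\ (2 < h)%N.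
Proof.
move=> k0 E; split; first by rewrite ltnNge; apply/negP => hk; nia.
rewrite ltnNge; apply/negP => h2.
have : (k <= 1)%N by nia.
by case: h E h2 => [|[|[|h]]]; nia.
Qed.

Lemma lucas_odd_gt0 (h j : nat) : (j <= h)%N -> (0 < lucas_odd h j)%N.
Proof. by move=> jh; rewrite addn_gt0 bin_gt0; apply/orP; left; lia. Qed.

Lemma lucas_even1 (k : nat) : lucas_even k 1 = (k ^ 2)%N.
Proof. by have := lucas_even_ratio k 0; rewrite lucas_even0 subn0 addn0; lia. Qed.

Lemma lucas_odd1 (h k : nat) : (h * h.+1 = 3 * k ^ 2)%N ->
  (2 * lucas_odd h 1 = h.*2.+1 * k ^ 2)%N.
Proof.
move=> E; have := lucas_odd_ratio h 0; rewrite lucas_odd0 subn0 addn0 E.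
by move: (k ^ 2)%N => q; lia.
Qed.

(** The two coefficient ratios, cross-multiplied. With h(h+1) = 3k^2 and j <= k, right minus left is
    j(4k^2 - 1), which is positive only from j = 1 on. *)
Lemma lucas_ratio_lt (h k j : nat) : (0 < k)%N -> (0 < j < h)%N ->
    (h * h.+1 = 3 * k ^ 2)%N ->
  ((k - j) * (k + j) * j.*2.+3 < (h - j) * (h + j).+1 * j.*2.+1)%N.
Proof.
move=> k0 /andP[j0 jh] E.
have [kj|jk] := leqP k j.
  by rewrite (eqP (_ : k - j == 0)%N) // !muln_gt0 subn_gt0 jh.
have X : ((k - j) * (k + j) + j * j = k ^ 2)%N.
  by rewrite -{2 3}(subnK (ltnW jk)); ring.
have Y : ((h - j) * (h + j).+1 + j * j + j = 3 * k ^ 2)%N.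
  by rewrite -E -{2 3 4}(subnK (ltnW jh)); ring.
have k2 : (1 <= k ^ 2)%N by rewrite expn_gt0 k0.
move: X Y; move: ((k - j) * (k + j))%N ((h - j) * (h + j).+1)%N => X Y.
have jk2 : (j <= j * k ^ 2)%N by rewrite leq_pmulr.
move: (k ^ 2)%N jk2 k2 => q jk2 q0 XE YE.
have {}YE : (Y + j = 3 * X + 2 * (j * j))%N by lia.
by nia.
Qed.

(** The hypothesis is not strict because the induction starts at j = 1, where [lucas_even1] and
    [lucas_odd1] give equality. *)
Lemma lucas_odd_gt_evenS (h k j : nat) : (0 < k)%N -> (0 < j < h)%N ->
    (h * h.+1 = 3 * k ^ 2)%N ->
  (h.*2.+1 * lucas_even k j <= 2 * lucas_odd h j)%N ->
  (h.*2.+1 * lucas_even k j.+1 < 2 * lucas_odd h j.+1)%N.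
Proof.
move=> k0 jh E ab; have lt := lucas_ratio_lt k0 jh E.
have a0 : (0 < 2 * lucas_odd h j)%N by rewrite muln_gt0 lucas_odd_gt0; lia.
rewrite -(@ltn_pmul2r (j.*2.+1 * j.*2.+2 * j.*2.+3)) //.
have -> : (h.*2.+1 * lucas_even k j.+1 * (j.*2.+1 * j.*2.+2 * j.*2.+3) =
  h.*2.+1 * lucas_even k j * ((k - j) * (k + j) * j.*2.+3))%N.
  by rewrite -mulnA (mulnA (lucas_even _ _)) lucas_even_ratio; ring.
have -> : (2 * lucas_odd h j.+1 * (j.*2.+1 * j.*2.+2 * j.*2.+3) =
  2 * lucas_odd h j * ((h - j) * (h + j).+1 * j.*2.+1))%N.
  rewrite -(mulnA j.*2.+1) (mulnC j.*2.+1) -mulnA (mulnA (lucas_odd _ _)).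
  by rewrite lucas_odd_ratio; ring.
by rewrite (leq_ltn_trans (leq_mul ab (leqnn _))) // ltn_pmul2l.
Qed.

Lemma lucas_odd_gt_even (h k j : nat) : (0 < k)%N ->
    (h * h.+1 = 3 * k ^ 2)%N -> (1 < j <= h)%N ->
  (h.*2.+1 * lucas_even k j < 2 * lucas_odd h j)%N.
Proof.
move=> k0 E; elim: j => [//|[//|j] IH] /andP[_ jh].
apply: lucas_odd_gt_evenS => //.
case: j IH jh => [|j] IH jh; first by rewrite lucas_even1 (lucas_odd1 E).
by apply/ltnW/IH; rewrite /= ltnW.
Qed.

(** * Values on the line x + y = 1 *)

(** Induction on k through the recurrence. The length N is free, since coefficients past index k
    vanish; this lets sums of different lengths be matched. *)
Lemma sum_lucas (R : comNzRingType) (x y : R) (k N : nat) :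
    x + y = 1 -> (k < N)%N ->
  \sum_(j < N) (lucas_even k j)%:R * x ^+ j.*2 * y ^+ (k - j) = 1 + y ^+ k.*2
  /\ \sum_(j < N) (lucas_odd k j)%:R * x ^+ j.*2.+1 * y ^+ (k - j)
     = 1 - y ^+ k.*2.+1.
Proof.
move=> xy; have xE : x = 1 - y by rewrite -xy; ring.
elim: k N => [|k IH] [//|N] kN.
  rewrite !big_ord_recl /= !big1 => [|i _|i _].
  - by rewrite lucas_even0 lucas_odd0 xE double0 subnn; split; ring.
  - by rewrite lucas_odd_small // !mul0r.
  - by rewrite lucas_even_small // !mul0r.
have [E1 O1] := IH N kN; have [E2 O2] := IH N.+1 (ltnW kN).
have E : \sum_(j < N.+1) (lucas_even k.+1 j)%:R * x ^+ j.*2 * y ^+ (k.+1 - j)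
         = 1 + y ^+ k.+1.*2.
  transitivity (x * (1 - y ^+ k.*2.+1) + y * (1 + y ^+ k.*2)); last first.
    by rewrite xE doubleS !exprS; ring.
  rewrite -O1 -E2 !mulr_sumr big_ord_recl [X in _ = _ + X]big_ord_recl /=.
  rewrite addrCA -big_split /=; congr (_ + _).
    by rewrite !lucas_even0 !subn0 exprS; ring.
  apply: eq_bigr => i _; rewrite /bump add1n lucas_evenS natrD subSS doubleS.
  (* Where k - (i+1) would be truncated, the coefficient is zero. *)
  have [ki|ik] := leqP k i; first by rewrite (@lucas_even_small k) // !exprS; ring.
  by rewrite -(subnSK ik) !exprS; ring.
split=> //.
transitivity (x * (1 + y ^+ k.+1.*2) + y * (1 - y ^+ k.*2.+1)); last first.
  by rewrite xE doubleS !exprS; ring.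
rewrite -E -O2 !mulr_sumr -big_split /=; apply: eq_bigr => i _.
rewrite lucas_oddS natrD.
have [ki|ik] := ltnP k i; first by rewrite (@lucas_odd_small k) // !exprS; ring.
by rewrite (subSn ik) !exprS; ring.
Qed.

(** * Polynomials given by a list of exponent pairs *)

Definition bimonom (e : nat * nat) : 'X_{1..2} := [multinom [tuple e.1; e.2]].

Lemma bimonom_inj : injective bimonom.
Proof.
move=> [a b] [a' b'] /mnmP eqm.
by have := eqm 0; have := eqm 1; rewrite !mnm_tnth !(tnth_nth 0%N) /= => -> ->.
Qed.

Lemma mdeg_bimonom (e : nat * nat) : mdeg (bimonom e) = (e.1 + e.2)%N.
Proof. by rewrite mdegE !big_ord_recl big_ord0 !mnm_tnth !(tnth_nth 0%N) addn0. Qed.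

Definition bipoly (R : realType) (s : seq (nat * nat)) (c : nat * nat -> R) :
  {mpoly R[2]} := \sum_(e <- s) c e *: 'X_[bimonom e].

Lemma mcoeff_bipoly (R : realType) s (c : nat * nat -> R) m : uniq s ->
  (bipoly s c)@_m = \sum_(e <- s | bimonom e == m) c e.
Proof.
move=> us; rewrite /bipoly raddf_sum [RHS]big_mkcond; apply: eq_bigr => e _ /=.
by rewrite mcoeffZ mcoeffX; case: ifP => _; rewrite ?mulr1 ?mulr0.
Qed.

Lemma mcoeff_bipoly_ge0 (R : realType) s (c : nat * nat -> R) m : uniq s ->
  (forall e, e \in s -> 0 < c e) -> 0 <= (bipoly s c)@_m.
Proof.
move=> us c0; rewrite mcoeff_bipoly // big_seq_cond sumr_ge0 // => e.
by case/andP => /c0/ltW.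
Qed.

(** Distinct pairs give distinct monomials, so no coefficients are added together and positivity
    keeps each one nonzero. *)
Lemma msupp_bipoly (R : realType) s (c : nat * nat -> R) : uniq s ->
  (forall e, e \in s -> 0 < c e) ->
  perm_eq (msupp (bipoly s c)) [seq bimonom e | e <- s].
Proof.
move=> us c0; apply: uniq_perm; rewrite ?msupp_uniq ?(map_inj_uniq bimonom_inj) //.
move=> m; rewrite mcoeff_msupp mcoeff_bipoly //.
apply/idP/idP => [|/mapP[e es ->]].
  apply: contraR => /mapP nm; apply/eqP; rewrite big_seq_cond.
  rewrite big1 // => e /andP[es /eqP em].
  by case: nm; exists e; rewrite // em.
under eq_bigl => e' do rewrite (inj_eq bimonom_inj).
by rewrite -big_filter filter_pred1_uniq // big_seq1 gt_eqF // c0.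
Qed.

Lemma meval_bipoly (R : realType) s (c : nat * nat -> R) (x y : R) :
  (bipoly s c).@[tnth [tuple x; y]] = \sum_(e <- s) c e * x ^+ e.1 * y ^+ e.2.
Proof.
rewrite /bipoly raddf_sum; apply: eq_bigr => e _ /=.
rewrite mevalZ mevalX !big_ord_recl big_ord0 !mnm_tnth !(tnth_nth 0%N) !(tnth_nth 0) mulr1.
by rewrite mulrA.
Qed.

Definition expands_one (R : realType) (d : nat) s (c : nat * nat -> R) :=
  [/\ uniq s, forall e, e \in s -> 0 < c e,
      forall x y, x + y = 1 -> \sum_(e <- s) c e * x ^+ e.1 * y ^+ e.2 = 1,
      forall e, e \in s -> (e.1 + e.2 <= d)%N
    & exists2 e, e \in s & (e.1 + e.2 = d)%N].

Lemma bipoly_H2d (R : realType) (d : nat) s (c : nat * nat -> R) :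
  expands_one d s c ->
  H2d d (bipoly s c) /\ num_monomials (bipoly s c) = size s.
Proof.
move=> [us c0 c1 sd [e es ed]]; have P := msupp_bipoly us c0.
split; last by rewrite /num_monomials (perm_size P) size_map.
split; first split.
- by move=> m; apply: mcoeff_bipoly_ge0.
- by move=> x y xy; rewrite meval_bipoly c1.
rewrite msizeE (perm_big _ P) big_map /=; apply/eqP; rewrite eqn_leq; apply/andP; split.
  by apply/bigmax_leqP_seq => e' e's _; rewrite mdeg_bimonom ltnS sd.
by rewrite -ed -mdeg_bimonom; apply: leq_bigmax_seq.
Qed.

Lemma bipoly_neq (R : realType) (d : nat) s s' (c c' : nat * nat -> R) e :
    expands_one d s c -> expands_one d s' c' ->
  (e \in s) != (e \in s') -> bipoly s c <> bipoly s' c'.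
Proof.
move=> [us c0 _ _ _] [us' c0' _ _ _] /negP ne eqp; apply: ne; apply/eqP.
rewrite -(mem_map bimonom_inj) -(perm_mem (msupp_bipoly us c0)) eqp.
by rewrite (perm_mem (msupp_bipoly us' c0')) (mem_map bimonom_inj).
Qed.

Definition swap_pair (e : nat * nat) : nat * nat := (e.2, e.1).

Lemma swap_pairK : involutive swap_pair. Proof. by case. Qed.

Lemma mem_swap s e : (e \in map swap_pair s) = (swap_pair e \in s).
Proof. by rewrite -{1}(swap_pairK e) (mem_map (inv_inj swap_pairK)). Qed.

Lemma expands_one_swap (R : realType) (d : nat) s (c : nat * nat -> R) :
  expands_one d s c -> expands_one d (map swap_pair s) (c \o swap_pair).
Proof.
move=> [us c0 c1 sd [e es ed]]; split.
- by rewrite (map_inj_uniq (inv_inj swap_pairK)).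
- by move=> e'; rewrite mem_swap; apply: c0.
- move=> x y xy; rewrite -(c1 y x) 1?addrC // big_map.
  by apply: eq_bigr => -[a b] _ /=; rewrite mulrAC.
- by move=> e'; rewrite mem_swap addnC; apply: sd.
- by exists (swap_pair e); rewrite ?mem_swap ?swap_pairK //= addnC.
Qed.

(** * The Lucas polynomial and its modification *)

Definition lucas_tail (h m n : nat) : seq (nat * nat) :=
  [seq (j.*2.+1, h - j)%N | j <- iota m n].

Definition lucas_supp (h : nat) : seq (nat * nat) :=
  (0, h.*2.+1)%N :: lucas_tail h 0 h.+1.

(** The exponent of x identifies the term: 0 means y^d, and halving 2j+1 recovers j. *)
Definition lucas_coef (R : realType) (h : nat) (e : nat * nat) : R :=
  if e.1 == 0%N then 1 else (lucas_odd h e.1./2)%:R.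

(** The tail starts at j = 2 because the terms for j = 0 and j = 1 cancel. *)
Definition pell_supp (h k : nat) : seq (nat * nat) :=
  [:: (0, h.*2.+1), (1, h - k), (1, h + k) & lucas_tail h 2 h.-1]%N.

Definition pell_coef (R : realType) (h k : nat) (e : nat * nat) : R :=
  if e.1 == 0%N then 1 else if e.1 == 1%N then h.*2.+1%:R / 2 else
  (lucas_odd h e.1./2)%:R - h.*2.+1%:R / 2 * (lucas_even k e.1./2)%:R.

Lemma lucas_tail_uniq (h m n : nat) : uniq (lucas_tail h m n).
Proof. by rewrite map_inj_uniq ?iota_uniq // => i j [/double_inj]. Qed.

Lemma mem_lucas_tail (h m n : nat) (e : nat * nat) :
  reflect (exists j, [/\ (m <= j)%N, (j < m + n)%N & e = (j.*2.+1, h - j)%N])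
    (e \in lucas_tail h m n).
Proof.
apply: (iffP mapP) => [[j]|[j [mj jn ->]]]; last by exists j; rewrite ?mem_iota ?mj.
by rewrite mem_iota => /andP[mj jn] ->; exists j.
Qed.

Lemma lucas_expands_one (R : realType) (h : nat) :
  expands_one h.*2.+1 (lucas_supp h) (lucas_coef R h).
Proof.
split.
- by rewrite cons_uniq lucas_tail_uniq andbT; apply/negP => /mem_lucas_tail[j []].
- move=> e; rewrite inE => /predU1P[->|/mem_lucas_tail[j [_ jh ->]]] /=.
    by rewrite /lucas_coef /= ltr01.
  by rewrite /lucas_coef /= uphalf_double ltr0n lucas_odd_gt0.
- move=> x y xy; rewrite big_cons big_map -[iota _ _]/(index_iota 0 h.+1).
  rewrite big_mkord /lucas_coef /=.
  under eq_bigr do rewrite uphalf_double.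
  by rewrite (sum_lucas xy (ltnSn h)).2; ring.
- move=> e; rewrite inE => /predU1P[->|/mem_lucas_tail[j [_ jh ->]]] /=; lia.
- by exists (0, h.*2.+1)%N; rewrite ?inE ?eqxx.
Qed.

Lemma pell_expands_one (R : realType) (h k : nat) : (0 < k)%N ->
    (h * h.+1 = 3 * k ^ 2)%N ->
  expands_one h.*2.+1 (pell_supp h k) (pell_coef R h k).
Proof.
move=> k0 E; have [kh h2] := pell_bound k0 E.
split.
- rewrite /pell_supp !cons_uniq lucas_tail_uniq andbT !inE !negb_or -!andbA.
  apply/and5P; split=> //.
  + by apply/negP => /mem_lucas_tail[j []].
  + by apply/eqP => -[]; lia.
  + by apply/andP; split; apply/negP => /mem_lucas_tail[[|j] []].
- move=> e; rewrite !inE.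
  case/or4P => [/eqP->|/eqP->|/eqP->|/mem_lucas_tail[j [j2 jh ->]]].
  + by rewrite /pell_coef /= ltr01.
  + by rewrite /pell_coef /= divr_gt0 ?ltr0n.
  + by rewrite /pell_coef /= divr_gt0 ?ltr0n.
  rewrite /pell_coef /= eqSS double_eq0 gtn_eqF 1?(ltn_trans _ j2) //.
  rewrite uphalf_double subr_gt0 mulrAC ltr_pdivrMr ?ltr0n //.
  rewrite -!natrM ltr_nat (mulnC (lucas_odd _ _)) lucas_odd_gt_even // j2; lia.
- move=> x y xy.
  pose T j : R := ((lucas_odd h j)%:R - h.*2.+1%:R / 2 * (lucas_even k j)%:R) *
    x ^+ j.*2.+1 * y ^+ (h - j).
  have T0 : T 0%N = 0.
    by rewrite /T lucas_odd0 lucas_even0 divfK ?subrr ?mul0r // pnatr_eq0.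
  have T1 : T 1%N = 0.
    have := lucas_odd1 E; move/(congr1 (fun n => n%:R : R)).
    rewrite (natrM _ 2) (natrM _ h.*2.+1) /T lucas_even1 => T1.
    by rewrite (mulrAC _ 2^-1) -T1 (mulrC 2%:R) mulfK ?subrr ?mul0r // pnatr_eq0.
  have tail : \sum_(e <- lucas_tail h 2 h.-1)
      pell_coef R h k e * x ^+ e.1 * y ^+ e.2 = \sum_(j < h.+1) T j.
    rewrite -(big_mkord xpredT) big_ltn // big_ltn; last by lia.
    rewrite T0 T1 !add0r big_map /index_iota subSS subn1.
    apply: eq_big_seq => j; rewrite mem_iota => /andP[j2 _].
    by rewrite /pell_coef /= eqSS double_eq0 gtn_eqF ?(ltn_trans _ j2) // uphalf_double.
  have sumT : \sum_(j < h.+1) T j = 1 - y ^+ h.*2.+1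
      - h.*2.+1%:R / 2 * x * y ^+ (h - k) * (1 + y ^+ k.*2).
    rewrite -(sum_lucas xy (ltnSn h)).2 -(sum_lucas xy (ltnW kh : k < h.+1)%N).1.
    rewrite mulr_sumr -sumrB; apply: eq_bigr => j _; rewrite /T.
    (* The exponent h - j splits as (h-k) + (k-j) only for j <= k; beyond that the even coefficient
       is zero. *)
    have [kj|jk] := ltnP k j; first by rewrite (@lucas_even_small k) //; ring.
    have -> : (h - j = (h - k) + (k - j))%N by lia.
    by rewrite exprD exprS; ring.
  rewrite !big_cons tail sumT /pell_coef /=.
  have -> : (h + k = (h - k) + k.*2)%N by lia.
  by rewrite exprD; ring.
- move=> e; rewrite !inE.
  case/or4P => [/eqP->|/eqP->|/eqP->|/mem_lucas_tail[j [j2 jh ->]]] /=; lia.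
- by exists (0, h.*2.+1)%N; rewrite ?inE ?eqxx.
Qed.

(** * Infinitely many solutions of the Pell equation *)

Lemma infinite_set_nat (A : set nat) :
  (forall n, exists2 m, (n < m)%N & A m) -> infinite_set A.
Proof.
move=> unb /finite_seqP[s sA].
have [m] := unb (\max_(i <- s) i)%N; rewrite sA ltnNge => /negP ms /= m_s.
by apply: ms; exact: (leq_bigmax_seq (F := id)).
Qed.

Lemma pell_odd (d k : nat) : (d ^ 2 = 12 * k ^ 2 + 1)%N -> odd d.
Proof.
move=> /(congr1 odd); rewrite oddX orFb => ->.
by rewrite oddD oddM.
Qed.

(* Multiplication by the fundamental unit [7 + 2 * sqrt 12]. *)
Lemma pell_step (d k : nat) : (d ^ 2 = 12 * k ^ 2 + 1)%N ->
  ((7 * d + 24 * k) ^ 2 = 12 * (2 * d + 7 * k) ^ 2 + 1)%N.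
Proof. rewrite -!mulnn; lia. Qed.

Lemma pell_unbounded (n : nat) : exists d k : nat,
  [/\ (n < d)%N, (0 < k)%N & (d ^ 2 = 12 * k ^ 2 + 1)%N].
Proof.
(* The fundamental solution is 7^2 = 12 * 2^2 + 1. *)
elim: n => [|n [d [k [nd k0 E]]]]; first by exists 7, 2.
exists (7 * d + 24 * k)%N, (2 * d + 7 * k)%N; split; [lia | lia |].
exact: pell_step.
Qed.

Theorem theorem1 (R : realType) :
  infinite_set [set d : nat | [/\ odd d, (0 < d)%N
     & exists k : nat, (0 < k)%N /\ (d ^ 2 = 12 * k ^ 2 + 1)%N]] /\
  (forall d k : nat, (0 < d)%N -> (0 < k)%N -> (d ^ 2 = 12 * k ^ 2 + 1)%N ->
     exists p1 p2 p3 : {mpoly R[2]},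
       [/\ p1 <> p2, p1 <> p3 & p2 <> p3] /\
       [/\ H2d d p1, H2d d p2 & H2d d p3] /\
       [/\ num_monomials p1 = ((d + 3) %/ 2)%N,
           num_monomials p2 = ((d + 3) %/ 2)%N
         & num_monomials p3 = ((d + 3) %/ 2)%N]).
Proof.
split.
  apply: infinite_set_nat => n.
  have [d [k [nd k0 E]]] := pell_unbounded n.
  by exists d => //; split; [exact: pell_odd E | exact: leq_ltn_trans nd | exists k].
move=> d k _ k0 E.
have [h dh] : exists h, d = h.*2.+1.
  by exists d./2; rewrite -[LHS]odd_double_half (pell_odd E).
have {}E : (h * h.+1 = 3 * k ^ 2)%N.
  by move: E; rewrite dh -!mulnn; lia.
rewrite {}dh; have [kh h2] := pell_bound k0 E.
have F1 := lucas_expands_one R h.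
have F2 := expands_one_swap F1.
have F3 := pell_expands_one R k0 E.
have [H1 N1] := bipoly_H2d F1.
have [H2 N2] := bipoly_H2d F2.
have [H3 N3] := bipoly_H2d F3.
exists (bipoly (lucas_supp h) (lucas_coef R h)).
exists (bipoly (map swap_pair (lucas_supp h)) (lucas_coef R h \o swap_pair)).
exists (bipoly (pell_supp h k) (pell_coef R h k)).
(* Supports tell the three apart: x y^h occurs only in the first, and x^(2h-1) y, the term j = h-1
   of the third, is missing from the second. Both facts about the second need h <> 1. *)
have lucas1h : (1, h)%N \in lucas_supp h.
  by rewrite inE; apply/orP; right; apply/mem_lucas_tail; exists 0%N; rewrite subn0.
have pell1h : (1, h)%N \notin pell_supp h k.
  rewrite !inE; apply/negP => /or4P[/eqP[]|/eqP[]|/eqP[]|]; try lia.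
  by move=> /mem_lucas_tail[[|j] []].
have swap1h : (1, h)%N \notin map swap_pair (lucas_supp h).
  rewrite mem_swap inE; apply/negP => /predU1P[[]|]; first by lia.
  by move=> /mem_lucas_tail[j [_ _ []]]; lia.
have pell3 : (h.-1.*2.+1, 1)%N \in pell_supp h k.
  rewrite !inE; apply/orP; right; apply/orP; right; apply/orP; right.
  by apply/mem_lucas_tail; exists h.-1; split; [lia | lia | congr (_, _); lia].
have swap3 : (h.-1.*2.+1, 1)%N \notin map swap_pair (lucas_supp h).
  rewrite mem_swap inE; apply/negP => /predU1P[[]|]; first by lia.
  by move=> /mem_lucas_tail[j [_ _ []]]; lia.
split; first split.
- by apply: (bipoly_neq F1 F2 (e := (1, h)%N)); rewrite lucas1h (negPf swap1h).
- by apply: (bipoly_neq F1 F3 (e := (1, h)%N)); rewrite lucas1h (negPf pell1h).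
- apply: (bipoly_neq F2 F3 (e := (h.-1.*2.+1, 1)%N)).
  by rewrite pell3 (negPf swap3).
split; split=> //; rewrite ?N1 ?N2 ?N3 ?size_map //.
(* The lists have 1 + (h+1) and 3 + (h-1) entries, both equal to h + 2 = (d+3)/2. *)
all: by rewrite /= size_map size_iota; lia.
Qed.
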